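(* Let $P_0,P_1\in\mathbb{S}^n_{++}$. Then $$P_t^{\rm omt}=\left((1-t)P_0^{1/2}+tP_1^{1/2}\hat U\right)\left((1-t)P_0^{1/2}+tP_1^{1/2}\hat U\right)',\qquad \hat U=P_1^{-1/2}P_0^{-1/2}\left(P_0^{1/2}P_1P_0^{1/2}\right)^{1/2},$$ is the unique minimizer of $$\min_{P_t,A_t}\left\{\int_0^1 \operatorname{tr}(A_tP_tA_t')\,dt\;\Big|\;\dot P_t=A_tP_t+P_tA_t',\ P_0,P_1\text{ specified}\right\},$$ and the optimal $A_t$ equals $$A_t^{\rm omt}=Q(tQ-I)^{-1},\qquad Q=I-P_0^{-1/2}\left(P_0^{1/2}P_1P_0^{1/2}\right)^{1/2}P_0^{-1/2}.$$ The optimal value of the objective function equals $\|P_0^{1/2}-P_1^{1/2}\hat U\|_{\rm F}^2$.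
   Context: $\mathbb{S}^n_{++}$ is the set of real symmetric positive definite $n\times n$ matrices; $'$ denotes transpose; $P^{1/2}$ is the unique positive definite square root of $P\in\mathbb{S}^n_{++}$; $\|\cdot\|_{\rm F}$ is the Frobenius norm. The minimization is over pairs $(P_t,A_t)_{t\in[0,1]}$ with $P_t\in\mathbb{S}^n_{++}$ continuously differentiable in $t$, $A_t\in\mathbb{R}^{n\times n}$ continuous in $t$, satisfying the stated differential equation, where $P_t$ takes the prescribed values $P_0$ at $t=0$ and $P_1$ at $t=1$. *)

(* Defs.v *)
From HB Require Import structures.
From mathcomp Require Import all_boot all_order all_algebra.
From mathcomp Require Import all_classical all_reals all_analysis.

Set Implicit Arguments.
Unset Strict Implicit.
Unset Printing Implicit Defensive.

Import Order.TTheory GRing.Theory Num.Theory.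
Import numFieldNormedType.Exports.

Local Open Scope classical_set_scope.
Local Open Scope ring_scope.

Definition posdefmx (R : realType) (n : nat) (P : 'M[R]_n) : Prop :=
  P^T = P /\ forall x : 'cV[R]_n, x != 0 -> 0 < (x^T *m P *m x) 0 0.

(* The square root of a positive definite P exists and is unique, so the
   default value 0 of [xget] is never used for such P. *)
Definition sqrtmx (R : realType) (n : nat) (P : 'M[R]_n) : 'M[R]_n :=
  xget 0 [set S : 'M[R]_n | posdefmx S /\ S *m S = P].

Definition frobnorm (R : realType) (m n : nat) (M : 'M[R]_(m, n)) : R :=
  Num.sqrt (\sum_i \sum_j M i j ^+ 2).

(* [f] has derivative [f' t] at each [t] in [D], where the difference quotient
   only involves points of [D]: at the endpoints of an interval this is the
   one-sided derivative. *)
Definition has_derivative_on (R : realType) (n : nat) (D : set R)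
    (f f' : R -> 'M[R]_n) : Prop :=
  forall t, D t ->
    (s - t)^-1 *: (f s - f t) @[s --> within D t^'] --> f' t.

(* Trajectories are functions on all of [R] of which only the values on [0, 1]
   are constrained. *)
Definition feasible (R : realType) (n : nat) (P0 P1 : 'M[R]_n)
    (P A : R -> 'M[R]_n) : Prop :=
  [/\ forall t, t \in `[0, 1] -> posdefmx (P t),
      exists P' : R -> 'M[R]_n,
        [/\ {within `[0, 1], continuous P'},
            has_derivative_on `[0, 1] P P' &
            forall t, t \in `[0, 1] -> P' t = A t *m P t + P t *m (A t)^T],
      {within `[0, 1], continuous A},
      P 0 = P0 &
      P 1 = P1].

(* The integrand is nonnegative whenever all [P t] are positive definite. *)
Definition cost (R : realType) (n : nat) (P A : R -> 'M[R]_n) : \bar R :=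
  (\int[lebesgue_measure]_(t in `[0%R, 1%R])
     (\tr (A t *m P t *m (A t)^T))%:E)%E.

Definition is_minimizer (R : realType) (n : nat) (P0 P1 : 'M[R]_n)
    (P A : R -> 'M[R]_n) : Prop :=
  feasible P0 P1 P A /\
  forall P' A', feasible P0 P1 P' A' -> (cost P A <= cost P' A')%E.

Definition optimal_value (R : realType) (n : nat) (P0 P1 : 'M[R]_n) : \bar R :=
  ereal_inf [set cost PA.1 PA.2 |
    PA in [set PA : (R -> 'M[R]_n) * (R -> 'M[R]_n) |
            feasible P0 P1 PA.1 PA.2]].

Definition omtU (R : realType) (n : nat) (P0 P1 : 'M[R]_n) : 'M[R]_n :=
  invmx (sqrtmx P1) *m invmx (sqrtmx P0)
    *m sqrtmx (sqrtmx P0 *m P1 *m sqrtmx P0).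

Definition omtP (R : realType) (n : nat) (P0 P1 : 'M[R]_n) (t : R) : 'M[R]_n :=
  let X := (1 - t) *: sqrtmx P0 + t *: (sqrtmx P1 *m omtU P0 P1) in
  X *m X^T.

Definition omtQ (R : realType) (n : nat) (P0 P1 : 'M[R]_n) : 'M[R]_n :=
  1%:M - invmx (sqrtmx P0) *m sqrtmx (sqrtmx P0 *m P1 *m sqrtmx P0)
           *m invmx (sqrtmx P0).

Definition omtA (R : realType) (n : nat) (P0 P1 : 'M[R]_n) (t : R) : 'M[R]_n :=
  omtQ P0 P1 *m invmx (t *: omtQ P0 P1 - 1%:M).

(* Main.v *)
(* Put [T = P0^{-1/2} (P0^{1/2} P1 P0^{1/2})^{1/2} P0^{-1/2}], a positive
   definite matrix with [T P0 T = P1], and [K_t = (1 - t) I + t T], so that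
   [Q = I - T] and the candidate is [P_t = K_t P0 K_t].  Its velocity
   [L_t = K_t' K_t^{-1}] is symmetric and solves the Riccati equation
   [L' = - L^2].  Hence, for every feasible pair [(P, A)],
     [d/dt tr(L P) = tr(A P A^T) - tr((A - L) P (A - L)^T)],
   and the cost is a constant depending only on the endpoints plus the integral
   of the nonnegative term [tr((A - L) P (A - L)^T)].  That integral vanishes
   only for [A = L], in which case [K_t^{-1} P_t K_t^{-1}] is constant. *)
Require Import Defs.
From HB Require Import structures.
From mathcomp Require Import all_boot all_order all_algebra.
From mathcomp Require Import all_classical all_reals all_analysis.
From mathcomp Require Import complex ring.

Set Implicit Arguments.
Unset Strict Implicit.
Unset Printing Implicit Defensive.

Import Order.TTheory GRing.Theory Num.Theory.
Import numFieldNormedType.Exports.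

Local Open Scope classical_set_scope.
Local Open Scope ring_scope.

(** * Positive definite matrices *)

(** A nonzero row of the left kernel of [P] would make the quadratic form vanish at its
    transpose. *)
Lemma posdefmx_unit (R : realType) (n : nat) (P : 'M[R]_n) :
  posdefmx P -> P \in unitmx.
Proof.
case=> Psym Ppos; rewrite -row_free_unit -kermx_eq0; apply/eqP/row_matrixP => i.
rewrite row0; set v := row i _.
have vP : v *m P = 0 by apply/sub_kermxP; exact: row_sub.
apply/eqP; apply: contraT => v0.
have := Ppos v^T; rewrite trmxK vP mul0mx mxE ltxx; apply.
by rewrite -trmx0 (inj_eq trmx_inj).
Qed.

Lemma posdefmx_congr (R : realType) (n : nat) (P B : 'M[R]_n) :
  posdefmx P -> B \in unitmx -> posdefmx (B^T *m P *m B).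
Proof.
move=> [Psym Ppos] Bu; split.
  by rewrite !trmx_mul trmxK Psym mulmxA.
move=> x x0; have := Ppos (B *m x); rewrite trmx_mul !mulmxA; apply.
by apply: contra_neq x0 => Bx0; rewrite -(mulKmx Bu x) Bx0 mulmx0.
Qed.

Lemma trmx_invmx_sym (R : comUnitRingType) (n : nat) (S : 'M[R]_n) :
  S^T = S -> (invmx S)^T = invmx S.
Proof. by move=> Ssym; rewrite trmx_inv Ssym. Qed.

Lemma posdefmx_comb (R : realType) (n : nat) (P P' : 'M[R]_n) (t : R) :
  0 <= t <= 1 -> posdefmx P -> posdefmx P' ->
  posdefmx ((1 - t) *: P + t *: P').
Proof.
move=> /andP[t0 t1] [Psym Ppos] [P'sym P'pos]; split.
  by rewrite linearD !linearZ/= Psym P'sym.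
move=> x x0; rewrite mulmxDr mulmxDl -!scalemxAr -!scalemxAl.
rewrite mxE [X in X + _]mxE [X in _ + X]mxE.
have := Ppos _ x0; have := P'pos _ x0; move: (_ 0 0) (_ 0 0) => a b a0 b0.
have [->|tn0] := eqVneq t 0; first by rewrite subr0 mul1r mul0r addr0.
rewrite ltr_wpDl ?mulr_ge0 ?subr_ge0 ?(ltW b0)// mulr_gt0//.
by rewrite lt_def tn0.
Qed.

Lemma dotmx_ge0 (R : realType) (n : nat) (x : 'cV[R]_n) : 0 <= (x^T *m x) 0 0.
Proof. by rewrite mxE sumr_ge0// => i _; rewrite mxE -expr2 sqr_ge0. Qed.

Lemma dotmx_eq0 (R : realType) (n : nat) (x : 'cV[R]_n) :
  (x^T *m x) 0 0 = 0 -> x = 0.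
Proof.
rewrite mxE => /eqP; rewrite psumr_eq0 => [/allP xx0|i _]; last first.
  by rewrite mxE -expr2 sqr_ge0.
apply/matrixP => i j; rewrite ord1 mxE.
by have := xx0 i (mem_index_enum _); rewrite mxE -expr2 sqrf_eq0 => /eqP.
Qed.

Lemma posdefmx1 (R : realType) (n : nat) : posdefmx (1%:M : 'M[R]_n).
Proof.
split=> [|x]; first exact: trmx1.
apply: contraNT; rewrite mulmx1 -leNgt => xx.
by apply/eqP/dotmx_eq0/eqP; rewrite eq_le xx dotmx_ge0.
Qed.

(** * Polynomial functional calculus and square roots *)

Lemma poly_interpolation (F : fieldType) (f : F -> F) (s : seq F) :
  exists p : {poly F}, forall x, x \in s -> p.[x] = f x.
Proof.
elim: s => [|y s [p IH]]; first by exists 0.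
have [ys|yNs] := boolP (y \in s).
  by exists p => x; rewrite inE => /predU1P[->|]; exact: IH.
(* [q] vanishes at the earlier nodes and not at [y], so adding a multiple of it corrects the value
   at [y] alone. *)
pose q := \prod_(z <- s) ('X - z%:P).
have qy : q.[y] != 0 by rewrite -[_ != 0]/(~~ root q y) root_prod_XsubC.
exists (p + ((f y - p.[y]) / q.[y]) *: q) => x.
rewrite inE hornerD hornerZ => /predU1P[->|xs].
  by rewrite divfK// addrC subrK.
have /rootP -> : root q x by rewrite root_prod_XsubC.
by rewrite mulr0 addr0 IH.
Qed.

Lemma posdefmx_eigenvalue_gt0 (R : realType) (n : nat) (P : 'M[R]_n) (a : R) :
  posdefmx P -> eigenvalue P a -> 0 < a.
Proof.
move=> [_ Ppos] /eigenvalueP[v vP v0].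
have vT0 : v^T != 0 by rewrite -trmx0 (inj_eq trmx_inj).
have vv : 0 < (v *m v^T) 0 0.
  rewrite lt_def -{3}[v]trmxK dotmx_ge0 andbT.
  by apply: contra_neq vT0 => vv; apply: dotmx_eq0; rewrite trmxK.
by have := Ppos _ vT0; rewrite trmxK vP -scalemxAl mxE pmulr_lgt0.
Qed.

Lemma horner_mx_sym (R : comNzRingType) (n : nat) (A : 'M[R]_n.+1)
  (p : {poly R}) : A^T = A -> (horner_mx A p)^T = horner_mx A p.
Proof.
move=> Asym; elim/poly_ind: p => [|p c IH]; first by rewrite rmorph0 trmx0.
rewrite rmorphD rmorphM/= horner_mx_X horner_mx_C.
rewrite linearD/= -mulmxE trmx_mul IH Asym tr_scalar_mx.
congr (_ + _); rewrite mulmxE.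
by have := congr1 (horner_mx A) (mulrC 'X p); rewrite !rmorphM/= horner_mx_X.
Qed.

Lemma horner_mx_diagonalizable_fix (F : fieldType) (n : nat) (V : 'M[F]_n.+1)
    (d : 'rV[F]_n.+1) (p : {poly F}) :
  V \in unitmx -> (forall j, p.[d 0 j] = d 0 j) ->
  horner_mx (invmx V *m diag_mx d *m V) p = invmx V *m diag_mx d *m V.
Proof.
move=> Vu pd; rewrite horner_mx_uconjC// horner_mx_diag.
by congr (_ *m diag_mx _ *m _); apply/matrixP => i j; rewrite ord1 mxE pd.
Qed.

(* The spectral theorem is only available over an algebraically closed field;
   a polynomial in [P] interpolating the root on the (real) spectrum brings the
   result back to [R]. *)
Lemma horner_mx_fun_calculus (R : realType) (n : nat) (P : 'M[R]_n.+1)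
    (f : R -> R) (q : {poly R}) :
  P^T = P ->
  (forall a, eigenvalue P a -> q.[f a] = a) ->
  exists p : {poly R}, horner_mx P (q \Po p) = P.
Proof.
move=> Psym qf; pose PC := map_mx (real_complex R) P.
have PCherm : PC \is hermsymmx.
  apply: realsym_hermsym.
    by apply/is_hermitianmxP; rewrite expr0 scale1r map_mx_id// map_trmx Psym.
  apply/mxOverP => i j; rewrite mxE; apply/complex_realP; eexists; reflexivity.
have Vu : spectralmx PC \in unitmx by exact: spectral_unit.
have /orthomx_spectralP PCE := hermitian_normalmx PCherm.
have dreal := hermitian_spectral_diag_real PCherm.
move: Vu PCE dreal; set V := spectralmx PC; set d := spectral_diag PC.
move=> Vu PCE dreal.
(* Row [j] of [V] is a left eigenvector of [PC] for [d 0 j]; this entry is real, so it is already an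
   eigenvalue of [P] over [R]. *)
have {dreal} dE j : exists2 a, eigenvalue P a & d 0 j = real_complex R a.
  have /complex_realP[a da] := mxOverP dreal 0 j.
  exists a => //; rewrite -(eigenvalue_map (real_complex R)).
  apply/eigenvalueP; exists (row j V).
    rewrite -/PC {1}PCE -row_mul !mulmxA mulmxV// mul1mx row_mul.
    by rewrite row_diag_mx -scalemxAl -rowE da.
  apply/eqP => /(congr1 (mulmx^~ (invmx V))).
  rewrite -row_mul mulmxV// mul0mx => /matrixP/(_ 0 j).
  by rewrite !mxE eqxx => /eqP; rewrite oner_eq0.
(* The diagonal entries are real, so their real parts list the spectrum as interpolation nodes in
   [R]. *)
pose s := [seq complex.Re (d 0 j) | j <- enum 'I_n.+1].
have [p pE] := poly_interpolation f s; exists p.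
apply: (@map_mx_inj _ _ (real_complex R)); rewrite -/PC map_horner_mx -/PC.
rewrite PCE; apply: horner_mx_diagonalizable_fix => // j.
have [a Pa da] := dE j; rewrite da horner_map/=; congr (real_complex R _).
rewrite horner_comp pE ?qf//.
by apply/mapP; exists j; rewrite ?mem_enum// da.
Qed.

Lemma posdefmx_sqrt_exists (R : realType) (n : nat) (P : 'M[R]_n) :
  posdefmx P -> exists S, posdefmx S /\ S *m S = P.
Proof.
case: n P => [|n] P Ppos.
  by exists P; split=> //; apply/matrixP => -[].
have [Psym Ppos'] := Ppos.
(* A fourth root [Z] is taken instead of a square root: [Z] is symmetric, so [Z *m Z = Z^T *m Z] is
   positive semidefinite at once, and [Z *m x = 0] would force [P *m x = 0]. *)
have [p pP] : exists p : {poly R}, horner_mx P ('X^4 \Po p) = P.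
  apply: (@horner_mx_fun_calculus _ _ _ (fun x => Num.sqrt (Num.sqrt x))) => //.
  move=> a /(posdefmx_eigenvalue_gt0 Ppos) a0; rewrite hornerXn.
  by rewrite -[4%N]/(2 * 2)%N exprM !sqr_sqrtr ?sqrtr_ge0// ltW.
set Z := horner_mx P p.
have ZE : Z *m Z *m (Z *m Z) = P.
  rewrite -[RHS]pP comp_Xn_poly rmorphXn/= -/Z !mulmxE.
  by rewrite -!expr2 -exprM.
have Zsym : Z^T = Z by exact: horner_mx_sym.
exists (Z *m Z); split=> //; split; first by rewrite trmx_mul Zsym.
move=> x x0; rewrite -{1}Zsym mulmxA -trmx_mul -mulmxA lt_def dotmx_ge0 andbT.
apply: contra_neq x0 => /dotmx_eq0 Zx.
apply/eqP; apply: contraT => /Ppos'.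
by rewrite -ZE -!mulmxA Zx !mulmx0 mxE ltxx.
Qed.

Lemma sqrtmxP (R : realType) (n : nat) (P : 'M[R]_n) :
  posdefmx P -> posdefmx (sqrtmx P) /\ sqrtmx P *m sqrtmx P = P.
Proof.
by move=> /posdefmx_sqrt_exists; exact: (@xgetPex _ 0
  [set S : 'M[R]_n | posdefmx S /\ S *m S = P]).
Qed.

(** * Traces of congruences as sums of quadratic forms over rows *)

Lemma mxtrace_congrE (R : comNzRingType) (n : nat) (P B : 'M[R]_n) :
  \tr (B *m P *m B^T) = \sum_i (row i B *m P *m (row i B)^T) 0 0.
Proof.
apply: eq_bigr => i _; rewrite -row_mul [LHS]mxE [RHS]mxE.
by apply: eq_bigr => j _; rewrite !mxE.
Qed.

Lemma posdefmx_quad_ge0 (R : realType) (n : nat) (P : 'M[R]_n) (v : 'rV[R]_n) :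
  posdefmx P -> 0 <= (v *m P *m v^T) 0 0.
Proof.
move=> [_ Ppos]; have [->|v0] := eqVneq v 0; first by rewrite !mul0mx mxE.
have := Ppos v^T; rewrite trmxK => /(_ _)/ltW; apply.
by rewrite -trmx0 (inj_eq trmx_inj).
Qed.

Lemma mxtrace_congr_ge0 (R : realType) (n : nat) (P B : 'M[R]_n) :
  posdefmx P -> 0 <= \tr (B *m P *m B^T).
Proof.
move=> Ppos; rewrite mxtrace_congrE sumr_ge0// => i _.
exact: posdefmx_quad_ge0.
Qed.

Lemma mxtrace_congr_eq0 (R : realType) (n : nat) (P B : 'M[R]_n) :
  posdefmx P -> \tr (B *m P *m B^T) = 0 -> B = 0.
Proof.
move=> Ppos; rewrite mxtrace_congrE => /eqP.
rewrite psumr_eq0 => [/allP B0|i _]; last exact: posdefmx_quad_ge0.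
apply/row_matrixP => i; rewrite row0; apply/eqP; apply: contraT => Bi0.
have := Ppos.2 (row i B)^T; rewrite trmxK.
have /eqP -> := B0 i (mem_index_enum _); rewrite ltxx; apply.
by rewrite -trmx0 (inj_eq trmx_inj).
Qed.

Lemma frobnorm_sqr (R : realType) (m n : nat) (M : 'M[R]_(m, n)) :
  frobnorm M ^+ 2 = \tr (M *m M^T).
Proof.
rewrite /frobnorm sqr_sqrtr; last first.
  by rewrite sumr_ge0// => i _; rewrite sumr_ge0// => j _; rewrite sqr_ge0.
by apply: eq_bigr => i _; rewrite mxE; apply: eq_bigr => j _; rewrite mxE.
Qed.

(** * Limits and one-sided derivatives of matrix-valued functions *)

(** Coordinates are continuous; conversely, a neighbourhood of a matrix constrains only finitely
    many entries, and filters are closed under finite intersections. *)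
Lemma cvg_mxP (R : realType) (T : Type) (F : set_system T) {FF : Filter F}
    (m n : nat) (f : T -> 'M[R]_(m, n)) (L : 'M[R]_(m, n)) :
  f s @[s --> F] --> L <-> forall i j, f s i j @[s --> F] --> L i j.
Proof.
split=> [fL i j|fL].
  exact: (cvg_comp _ _ fL (@coord_continuous _ _ _ i j L)).
move=> U [P LP PU]; rewrite /fmap/=.
have : \forall s \near F, forall i j, P i j (f s i j).
  by apply: filter_forall => i; apply: filter_forall => j; exact: fL (LP i j).
by apply: filterS => s Pfs; exact: PU.
Qed.

Lemma cvg_mulmx (R : realType) (T : Type) (F : set_system T) {FF : Filter F}
    (m n p : nat) (f : T -> 'M[R]_(m, n)) (g : T -> 'M[R]_(n, p))
    (L : 'M[R]_(m, n)) (K : 'M[R]_(n, p)) :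
  f s @[s --> F] --> L -> g s @[s --> F] --> K ->
  f s *m g s @[s --> F] --> L *m K.
Proof.
move=> /cvg_mxP fL /cvg_mxP gK; apply/cvg_mxP => i j; rewrite mxE.
under eq_fun do rewrite mxE.
apply: (cvg_big add_continuous) => k _.
by apply: cvgM; [exact: fL|exact: gK].
Qed.

Lemma cvg_trmx (R : realType) (T : Type) (F : set_system T) {FF : Filter F}
    (m n : nat) (f : T -> 'M[R]_(m, n)) (L : 'M[R]_(m, n)) :
  f s @[s --> F] --> L -> (f s)^T @[s --> F] --> L^T.
Proof.
move=> /cvg_mxP fL; apply/cvg_mxP => i j; rewrite mxE.
by under eq_fun do rewrite mxE; exact: fL.
Qed.

Lemma cvg_mxtrace (R : realType) (T : Type) (F : set_system T) {FF : Filter F}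
    (n : nat) (f : T -> 'M[R]_n) (L : 'M[R]_n) :
  f s @[s --> F] --> L -> \tr (f s) @[s --> F] --> \tr L.
Proof.
by move=> /cvg_mxP fL; apply: (cvg_big add_continuous) => i _; exact: fL.
Qed.

Lemma cvg_determinant (R : realType) (T : Type) (F : set_system T)
    {FF : Filter F} (n : nat) (f : T -> 'M[R]_n) (L : 'M[R]_n) :
  f s @[s --> F] --> L -> \det (f s) @[s --> F] --> \det L.
Proof.
move=> /cvg_mxP fL; apply: (cvg_big add_continuous) => i _.
apply: cvgM; first exact: cvg_cst.
by apply: (cvg_big mul_continuous) => j _; exact: fL.
Qed.

Lemma cvg_invmx (R : realType) (T : Type) (F : set_system T) {FF : Filter F}
    (n : nat) (f : T -> 'M[R]_n) (L : 'M[R]_n) :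
  L \in unitmx -> f s @[s --> F] --> L -> invmx (f s) @[s --> F] --> invmx L.
Proof.
move=> Lu fL.
have detfL : \det (f s) @[s --> F] --> \det L by exact: cvg_determinant.
have L0 : \det L != 0 by rewrite -unitfE -unitmxE.
(* The determinant is nonzero near the limit, so the adjugate formula applies there; on singular
   matrices [invmx] returns its argument. *)
have invE : \forall s \near F, (\det (f s))^-1 *: \adj (f s) = invmx (f s).
  apply: filterS (cvgr_neq0 _ detfL L0) => s fs0.
  by rewrite /invmx unitmxE unitfE fs0.
move/near_eq_cvg/cvg_trans: invE; apply.
rewrite /invmx Lu; apply: cvgZ; first exact: cvgV.
apply/cvg_mxP => i j; rewrite mxE; under eq_fun do rewrite mxE.
apply: cvgM; first exact: cvg_cst.
apply: cvg_determinant; apply/cvg_mxP => k l; rewrite !mxE.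
under eq_fun do rewrite !mxE.
by move/cvg_mxP : fL; exact.
Qed.

(** For square matrices this unfolds to [has_derivative_on]; a general normed codomain also covers
    traces and entries. *)
Definition has_deriv_within (R : realType) (V : normedModType R) (D : set R)
    (f f' : R -> V) : Prop :=
  forall t, D t -> (s - t)^-1 *: (f s - f t) @[s --> within D t^'] --> f' t.

Lemma has_deriv_within_cvg (R : realType) (V : normedModType R) (D : set R)
    (f f' : R -> V) :
  has_deriv_within D f f' ->
  forall t, D t -> f s @[s --> within D (nbhs t)] --> f t.
Proof.
move=> df t Dt.
have h : f s @[s --> within D t^'] --> f t.
  (* Away from [t], [f s] is recovered from the difference quotient, whose factor [s - t] tends to
     0. *)
  have st : \forall s \near within D t^',
      f t + (s - t) *: ((s - t)^-1 *: (f s - f t)) = f s.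
    rewrite !near_withinE; apply: nearW => s st _.
    by rewrite scalerA divff ?subr_eq0// scale1r addrC subrK.
  move/near_eq_cvg/cvg_trans: st; apply.
  have st0 : s - t @[s --> within D t^'] --> (0 : R).
    rewrite -(subrr t); apply: cvgB; last exact: cvg_cst.
    by apply: cvg_trans (@cvg_within _ _ _ D) _; exact: cvg_within.
  have := cvgD (cvg_cst (f t)) (cvgZ st0 (df t Dt)).
  by rewrite scale0r addr0; apply.
(* The limit so far is over the punctured neighbourhood; the point [t] itself is put back. *)
move=> U Ut; have hU : \forall s \near t, s != t -> D s -> U (f s) := h U Ut.
change (\forall s \near t, D s -> U (f s)).
apply: filterS hU => s; have [->|st] := eqVneq s t; last exact.
by move=> _ _; exact: nbhs_singleton.
Qed.

Lemma within_dnbhs_within (T : topologicalType) (D : set T) (t : T) :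
  within D t^' --> within D (nbhs t).
Proof.
move=> U DU; change (\forall s \near t, s != t -> D s -> U s).
have {}DU : \forall s \near t, D s -> U s := DU.
by apply: filterS DU => s Us _.
Qed.

Lemma has_deriv_within_mulmx (R : realType) (m n p : nat) (D : set R)
    (f f' : R -> 'M[R]_(m, n)) (g g' : R -> 'M[R]_(n, p)) :
  has_deriv_within D f f' -> has_deriv_within D g g' ->
  has_deriv_within D (fun t => f t *m g t) (fun t => f' t *m g t + f t *m g' t).
Proof.
move=> df dg t Dt.
(* Leibniz splitting with [g] taken at [s] and [f] frozen at [t]; the first term then needs the
   continuity of [g]. *)
have E s : (s - t)^-1 *: (f s *m g s - f t *m g t) =
    ((s - t)^-1 *: (f s - f t)) *m g s + f t *m ((s - t)^-1 *: (g s - g t)).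
  rewrite -scalemxAl -scalemxAr -scalerDr mulmxBl mulmxBr addrA.
  by rewrite subrK.
under eq_fun do rewrite E.
apply: cvgD; apply: cvg_mulmx; [exact: df| |exact: cvg_cst|exact: dg].
apply: cvg_trans (has_deriv_within_cvg dg Dt).
apply: cvg_app; exact: within_dnbhs_within.
Qed.

Lemma has_deriv_within_cst (R : realType) (V : normedModType R) (D : set R)
    (v : V) :
  has_deriv_within D (fun=> v) (fun=> 0).
Proof.
move=> t Dt; under eq_fun do rewrite subrr scaler0.
exact: cvg_cst.
Qed.

Lemma has_deriv_within_affine (R : realType) (V : normedModType R) (D : set R)
    (u v : V) :
  has_deriv_within D (fun t => u + t *: v) (fun=> v).
Proof.
move=> t Dt.
have E : \forall s \near within D t^',
    v = (s - t)^-1 *: (u + s *: v - (u + t *: v)).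
  rewrite !near_withinE; apply: nearW => s st _.
  by rewrite [u + _]addrC addrKA -scalerBl scalerA mulVf ?scale1r// subr_eq0.
by move/near_eq_cvg/cvg_trans: E; apply; exact: cvg_cst.
Qed.

Lemma has_deriv_within_invmx (R : realType) (n : nat) (D : set R)
    (f f' : R -> 'M[R]_n) :
  has_deriv_within D f f' -> (forall t, D t -> f t \in unitmx) ->
  has_deriv_within D (fun t => invmx (f t))
    (fun t => - (invmx (f t) *m f' t *m invmx (f t))).
Proof.
move=> df fu t Dt.
(* Resolvent identity: the difference of inverses is minus the difference of the matrices,
   multiplied by [invmx (f s)] on the left and [invmx (f t)] on the right. *)
have E : \forall s \near within D t^',
    - (invmx (f s) *m ((s - t)^-1 *: (f s - f t)) *m invmx (f t)) =
    (s - t)^-1 *: (invmx (f s) - invmx (f t)).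
  rewrite !near_withinE; apply: nearW => s _ Ds.
  rewrite -scalemxAr -scalemxAl -scalerN.
  rewrite mulmxBr mulmxBl mulVmx ?fu// mul1mx -mulmxA mulmxV ?fu// mulmx1.
  by rewrite opprB.
move/near_eq_cvg/cvg_trans: E; apply.
apply: cvgN; apply: cvg_mulmx; last exact: cvg_cst.
apply: cvg_mulmx; last exact: df.
apply: cvg_invmx; first exact: fu.
apply: cvg_trans (has_deriv_within_cvg df Dt).
by apply: cvg_app; exact: within_dnbhs_within.
Qed.

Lemma has_deriv_within_mxtrace (R : realType) (n : nat) (D : set R)
    (f f' : R -> 'M[R]_n) :
  has_deriv_within D f f' ->
  has_deriv_within D (fun t => \tr (f t)) (fun t => \tr (f' t)).
Proof.
move=> df t Dt.
have -> : (fun s => (s - t)^-1 *: (\tr (f s) - \tr (f t))) =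
    (fun s => \tr ((s - t)^-1 *: (f s - f t))).
  by apply/funext => s; rewrite mxtraceZ [in RHS]raddfB.
by apply: cvg_mxtrace; exact: df.
Qed.

Lemma has_deriv_within_subset (R : realType) (V : normedModType R)
    (D E : set R) (f f' : R -> V) :
  E `<=` D -> has_deriv_within D f f' -> has_deriv_within E f f'.
Proof.
move=> ED df t Et; apply: cvg_trans (df t (ED _ Et)); apply: cvg_app.
move=> U DU; have {}DU : \forall s \near t, s != t -> D s -> U s := DU.
change (\forall s \near t, s != t -> E s -> U s).
by apply: filterS DU => s + st Es; apply=> //; exact: ED.
Qed.

(** * Passage from one-sided derivatives to integrals, and vanishing integrals *)

Lemma has_deriv_within_is_derive (R : realType) (V : normedModType R)
    (a b : R) (f f' : R -> V) (t : R) :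
  has_deriv_within `[a, b] f f' -> t \in `]a, b[ -> is_derive t 1 f (f' t).
Proof.
move=> df tab.
have tab' : t \in `[a, b] by exact: subset_itv_oo_cc.
have h : h^-1 *: ((f \o shift t) (h *: 1) - f t) @[h --> 0^'] --> f' t.
  move=> U /(df t tab') dU.
  have {}dU : \forall s \near t, s != t -> `[a, b]%classic s ->
    U ((s - t)^-1 *: (f s - f t)) := dU.
  (* Since [t] is interior, all nearby [s] lie in the interval and the restriction to it
     disappears. *)
  have {}dU : \forall s \near t, s != t -> U ((s - t)^-1 *: (f s - f t)).
    have := near_in_itvoo tab.
    apply: filterS2 dU => s sU sab st; apply: sU => //=.
    exact: subset_itv_oo_cc.
  have {}dU : \forall h \near (0 : R), h + t != t ->
      U ((h + t - t)^-1 *: (f (h + t) - f t)).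
    by move: dU; rewrite (near_shift 0) subr0.
  change (\forall h \near (0 : R), h != 0 ->
    U (h^-1 *: (f (h *: (1 : R) + t) - f t))).
  apply: filterS dU => h; rewrite addrK => hU h0.
  by rewrite [h *: _]mulr1; apply: hU; rewrite -subr_eq0 addrK.
by split; [apply/cvg_ex; exists (f' t)|exact: cvg_lim].
Qed.

Lemma integral_has_deriv_within (R : realType) (a b : R) (f f' : R -> R) :
  a < b -> {within `[a, b], continuous f'} ->
  has_deriv_within `[a, b] f f' ->
  (\int[lebesgue_measure]_(x in `[a, b]) (f' x)%:E = (f b - f a)%:E)%E.
Proof.
move=> ab cf' df; rewrite EFinB; apply: continuous_FTC2 => //.
  have /(continuous_within_itvP _ ab)[_ fa fb] : {within `[a, b], continuous f}.
    by apply/subspace_continuousP => t; exact: has_deriv_within_cvg df t.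
  by split=> // t tab; have [] := has_deriv_within_is_derive df tab.
by move=> t tab; rewrite derive1E; have [] := has_deriv_within_is_derive df tab.
Qed.

(** The fundamental theorem of calculus on [[a, t]] gives [f t - f a] as the integral of 0. *)
Lemma has_deriv_within0_cst (R : realType) (a b : R) (f : R -> R) :
  has_deriv_within `[a, b] f (fun=> 0) ->
  forall t, t \in `[a, b] -> f t = f a.
Proof.
move=> df t /[!in_itv]/= /andP[]; rewrite le_eqVlt => /predU1P[<-//|at_ tb].
have dft : has_deriv_within `[a, t] f (fun=> 0).
  apply: has_deriv_within_subset df => s /=.
  by rewrite !in_itv/= => /andP[-> /le_trans]; exact.
have := integral_has_deriv_within at_ _ dft.
rewrite integral0 => /(_ _)/esym intf; apply/eqP; rewrite -subr_eq0 -eqe intf//.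
by apply/subspace_continuousP => s _; exact: cvg_cst.
Qed.

(** A zero integral confines the nonzero values of [f] to a null set; a nonzero value at [t] would
    persist, by continuity, on an interval of positive length. *)
Lemma continuous_ge0_integral_eq0 (R : realType) (a b : R) (f : R -> R) :
  a < b -> {within `[a, b], continuous f} ->
  (forall t, t \in `[a, b] -> 0 <= f t) ->
  (\int[lebesgue_measure]_(x in `[a, b]) (f x)%:E = 0)%E ->
  forall t, t \in `[a, b] -> f t = 0.
Proof.
move=> ab cf f0 intf t tab.
have /integrableP[mf _] :=
  continuous_compact_integrable (@segment_compact _ a b) cf.
have /(iffLR (ae_eq_integral_abs lebesgue_measure (measurable_itv _) mf))
    [N [mN N0 fN]] :
    (\int[lebesgue_measure]_(x in `[a, b]) `|(EFin \o f) x| = 0)%E.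
  rewrite -[RHS]intf.
  by apply: eq_integral => s /[!inE] sab/=; rewrite ger0_norm// f0.
apply/eqP; apply: contraT => ft0.
have [e/= e0 fe] : \forall s \near t, `[a, b]%classic s -> f s != 0.
  move/subspace_continuousP : cf => /(_ t tab) /cvgr_neq0; exact.
have [ta tb] : a <= t /\ t <= b by move: tab; rewrite in_itv/= => /andP.
(* Clipping to [[a, b]] keeps the interval nondegenerate even when [t] is an endpoint. *)
pose c := Num.max a (t - e); pose d := Num.min b (t + e).
have cd : c < d.
  rewrite lt_min !gt_max ab/= ltrBlDr (le_lt_trans tb) ?ltrDl//=.
  by rewrite (le_lt_trans ta) ?ltrDl//= (@lt_trans _ _ t) ?gtrBl ?ltrDl.
have cdN : `]c, d[ `<=` N.
  move=> s; rewrite /= in_itv/= gt_max lt_min.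
  move=> /andP[/andP[as_ ts] /andP[sb st]].
  have sab : s \in `[a, b] by rewrite in_itv/= !ltW.
  apply: fN => /= /(_ sab) [] /eqP; apply/negP; apply: fe => //=.
  by rewrite ltr_distlC ts st.
have : (lebesgue_measure `]c, d[ <= lebesgue_measure N)%E.
  by apply: le_measure; rewrite ?inE//; exact: measurable_itv.
rewrite N0 lebesgue_measure_itv/= lte_fin cd -EFinB lee_fin.
by rewrite leNgt subr_gt0 cd.
Qed.

(** * Displacement interpolation *)

Lemma has_deriv_within_coord (R : realType) (m n : nat) (D : set R)
    (f f' : R -> 'M[R]_(m, n)) (i : 'I_m) (j : 'I_n) :
  has_deriv_within D f f' ->
  has_deriv_within D (fun t => f t i j) (fun t => f' t i j).
Proof.
move=> df t Dt; have /cvg_mxP/(_ i j) := df t Dt.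
by under eq_fun do rewrite !mxE; apply.
Qed.

Lemma eq_has_deriv_within (R : realType) (V : normedModType R) (D : set R)
    (f f' g' : R -> V) :
  (forall t, D t -> f' t = g' t) ->
  has_deriv_within D f f' -> has_deriv_within D f g'.
Proof. by move=> fg df t Dt; rewrite -fg//; exact: df. Qed.

(** After expansion and cyclic permutation only four traces occur. The first term on the right is
    the derivative of [\tr (L *m P)] once [L' = - L^2] and the constraint on [P] hold. *)
Lemma mxtrace_completed_square (R : comNzRingType) (n : nat)
    (A L P : 'M[R]_n) : L^T = L ->
  \tr (A *m P *m A^T) =
  \tr (- (L *m L) *m P + L *m (A *m P + P *m A^T)) +
  \tr ((A - L) *m P *m (A - L)^T).
Proof.
move=> Lsym; rewrite linearB/= Lsym !(mulmxBl, mulmxBr, mulmxDr) mulNmx !mulmxA.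
rewrite !(mxtraceD, linearB, linearN)/= !opprB.
rewrite (mxtrace_mulC (A *m P) L) (mxtrace_mulC (L *m P) L) !mulmxA.
move: (\tr _) (\tr _) (\tr _) (\tr _) => a b c d; ring.
Qed.

(** This is [K_t], in the affine form whose derivative is read off from
    [has_deriv_within_affine]. *)
Definition interp_map (R : realType) (n : nat) (T : 'M[R]_n) (t : R) :=
  1%:M + t *: (T - 1%:M).

Definition interp_velocity (R : realType) (n : nat) (T : 'M[R]_n) (t : R) :=
  (T - 1%:M) *m invmx (interp_map T t).

Section displacement_interpolation.
Context (R : realType) (n : nat) (T : 'M[R]_n) (Tpos : posdefmx T).
Let B := T - 1%:M.
Let K := interp_map T.
Let L := interp_velocity T.

Lemma interp_map_posdef t : t \in `[0, 1] -> posdefmx (interp_map T t).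
Proof.
rewrite in_itv/= => t01.
have -> : interp_map T t = (1 - t) *: 1%:M + t *: T.
  by rewrite /interp_map scalerBr scalerBl scale1r (addrC (t *: T)) addrA.
exact: posdefmx_comb t01 (posdefmx1 R n) Tpos.
Qed.

Lemma interp_map_unit t : t \in `[0, 1] -> interp_map T t \in unitmx.
Proof. by move=> t01; exact/posdefmx_unit/interp_map_posdef. Qed.

Let Bsym : B^T = B.
Proof. by rewrite /B linearB/= trmx1; case: Tpos => ->. Qed.

Lemma interp_map_sym t : (interp_map T t)^T = interp_map T t.
Proof. by rewrite /interp_map linearD linearZ/= trmx1 -/B Bsym. Qed.

(** [K_t] is affine in [T - 1%:M] and so commutes with it. Having both orders of the factors gives
    the symmetry of the velocity and the cancellations with [K_t] on either side. *)
Lemma interp_velocityC t : t \in `[0, 1] ->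
  interp_velocity T t = invmx (interp_map T t) *m (T - 1%:M).
Proof.
move=> t01; have Ku := interp_map_unit t01.
have KB : K t *m B = B *m K t.
  by rewrite /K /interp_map mulmxDl mulmxDr mul1mx mulmx1 -scalemxAl -scalemxAr.
rewrite /interp_velocity -[LHS](mulKmx Ku); congr (_ *m _).
by rewrite mulmxA KB mulmxK.
Qed.

Lemma interp_velocity_sym t : t \in `[0, 1] ->
  (interp_velocity T t)^T = interp_velocity T t.
Proof.
move=> t01; rewrite {2}interp_velocityC// /interp_velocity trmx_mul -/B Bsym.
by rewrite trmx_invmx_sym// interp_map_sym.
Qed.

Lemma has_deriv_within_interp_map (D : set R) :
  has_deriv_within D (interp_map T) (fun=> T - 1%:M).
Proof. exact: has_deriv_within_affine. Qed.

Lemma has_deriv_within_interp_inv :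
  has_deriv_within `[0, 1] (fun t => invmx (interp_map T t))
    (fun t =>
      - (invmx (interp_map T t) *m (T - 1%:M) *m invmx (interp_map T t))).
Proof.
by apply: has_deriv_within_invmx;
  [exact: has_deriv_within_interp_map|exact: interp_map_unit].
Qed.

(* The Riccati equation is what makes [interp_velocity T] a calibration. *)
Lemma interp_velocity_riccati :
  has_deriv_within `[0, 1] (interp_velocity T)
    (fun t => - (interp_velocity T t *m interp_velocity T t)).
Proof.
have dL := has_deriv_within_mulmx (has_deriv_within_cst (T - 1%:M))
  has_deriv_within_interp_inv.
apply: eq_has_deriv_within dL => t _.
by rewrite mul0mx add0r mulmxN !mulmxA.
Qed.

Lemma feasible_deriv (P0 P1 : 'M[R]_n) (P A : R -> 'M[R]_n) :
  feasible P0 P1 P A ->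
  has_deriv_within `[0, 1] P (fun t => A t *m P t + P t *m (A t)^T).
Proof.
by move=> [_ [P' [_ dP P'E]] _ _ _]; apply: eq_has_deriv_within dP.
Qed.

(** The calibration identity. Continuity of the remainder is recorded because a zero integral will
    have to force pointwise vanishing. *)
Lemma cost_completed_square (P0 P1 : 'M[R]_n) (P A : R -> 'M[R]_n) :
  feasible P0 P1 P A ->
  {within `[0, 1], continuous (fun t =>
     \tr ((A t - interp_velocity T t) *m P t *m
          (A t - interp_velocity T t)^T))} /\
  cost P A =
  ((\tr (interp_velocity T 1 *m P1) - \tr (interp_velocity T 0 *m P0))%:E +
   \int[lebesgue_measure]_(t in `[0%R, 1%R])
     (\tr ((A t - interp_velocity T t) *m P t *m
           (A t - interp_velocity T t)^T))%:E)%E.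
Proof.
move=> fPA; have dP := feasible_deriv fPA.
have cP := has_deriv_within_cvg dP.
have cL := has_deriv_within_cvg interp_velocity_riccati.
have [_ _ /subspace_continuousP cA <- <-] := fPA.
set g := (fun t => \tr ((A t - _) *m _ *m _)).
pose f t := \tr (- (L t *m L t) *m P t +
                 L t *m (A t *m P t + P t *m (A t)^T)).
have cg : {within `[0, 1], continuous g}.
  apply/subspace_continuousP => t t01; apply: cvg_mxtrace.
  have cAL : A s - L s @[s --> within `[0, 1] (nbhs t)] --> A t - L t.
    by apply: cvgB; [exact: cA|exact: cL].
  by apply: cvg_mulmx; [apply: cvg_mulmx => //; exact: cP|exact: cvg_trmx].
have cf : {within `[0, 1], continuous f}.
  apply/subspace_continuousP => t t01; apply: cvg_mxtrace.
  have LL := cL t t01; have PP := cP t t01; have AA := cA t t01.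
  apply: cvgD; apply: cvg_mulmx => //; first by apply: cvgN; apply: cvg_mulmx.
  by apply: cvgD; apply: cvg_mulmx => //; exact: cvg_trmx.
(* By the Riccati equation and the constraint, [f] is the derivative of [\tr (L t *m P t)], so its
   integral is the boundary term. *)
have dLP := has_deriv_within_mxtrace
  (has_deriv_within_mulmx interp_velocity_riccati dP).
have /= <- := integral_has_deriv_within ltr01 cf dLP; split=> //.
have fint := continuous_compact_integrable (@segment_compact R 0 1) cf.
have gint := continuous_compact_integrable (@segment_compact R 0 1) cg.
rewrite -(integralD _ fint gint)//.
apply: eq_integral => t /[!inE] t01.
by rewrite -EFinD (mxtrace_completed_square _ _ (interp_velocity_sym t01)).
Qed.

Lemma feasible_interp (P0 : 'M[R]_n) : posdefmx P0 ->
  feasible P0 (T *m P0 *m T)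
    (fun t => interp_map T t *m P0 *m interp_map T t) (interp_velocity T).
Proof.
move=> P0pos.
have dK := @has_deriv_within_interp_map `[0, 1].
have dP : has_deriv_within `[0, 1] (fun t => K t *m P0 *m K t)
    (fun t => B *m P0 *m K t + K t *m P0 *m B).
  have := has_deriv_within_mulmx
    (has_deriv_within_mulmx dK (has_deriv_within_cst P0)) dK.
  apply: eq_has_deriv_within => t _.
  by rewrite mulmx0 addr0.
split=> [t t01| | | |].
- rewrite -{1}interp_map_sym; apply: posdefmx_congr => //.
  exact: interp_map_unit.
- exists (fun t => B *m P0 *m K t + K t *m P0 *m B); split=> //.
    apply/subspace_continuousP => t t01.
    have cK := has_deriv_within_cvg dK t01.
    by apply: cvgD; apply: cvg_mulmx => //; try apply: cvg_mulmx => //;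
      exact: cvg_cst.
  (* The left velocity is used as [B K^{-1}] and the right one as [K^{-1} B], so that each inverse
     meets an adjacent [K]. *)
  move=> t t01; rewrite interp_velocity_sym// {2}interp_velocityC//.
  rewrite /interp_velocity -/B -/(K t) !mulmxA mulmxKV ?interp_map_unit//.
  by rewrite mulmxK// interp_map_unit.
- apply/subspace_continuousP => t t01.
  exact: has_deriv_within_cvg interp_velocity_riccati t t01.
- by rewrite /interp_map scale0r addr0 mul1mx mulmx1.
- by rewrite /interp_map scale1r addrC subrK.
Qed.

(** [K' = L K] makes [K] the fundamental solution of the linear flow, so conjugating [P] by its
    inverse removes the motion; [K] is the identity at time 0. *)
Lemma interp_flow_unique (P0 P1 : 'M[R]_n) (P A : R -> 'M[R]_n) :
  feasible P0 P1 P A ->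
  (forall t, t \in `[0, 1] -> A t = interp_velocity T t) ->
  forall t, t \in `[0, 1] -> P t = interp_map T t *m P0 *m interp_map T t.
Proof.
move=> fPA AL t t01; pose M s := invmx (K s) *m P s *m invmx (K s).
have dM : has_deriv_within `[0, 1] M (fun=> 0).
  have dI := has_deriv_within_interp_inv.
  have := has_deriv_within_mulmx
    (has_deriv_within_mulmx dI (feasible_deriv fPA)) dI.
  apply: eq_has_deriv_within => s s01.
  rewrite AL// interp_velocity_sym// {2}interp_velocityC//.
  rewrite /interp_velocity -/B -/(K s) mulmxDr mulmxN !mulNmx !mulmxA.
  by rewrite addKr subrr.
have MP0 : M t = P0.
  (* Constancy from a zero derivative is a scalar statement, hence applied entry by entry. *)
  have -> : M t = M 0.
    apply/matrixP => i j.
    apply: (@has_deriv_within0_cst _ 0 1 (fun s => M s i j)) t01.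
    have := has_deriv_within_coord (i := i) (j := j) dM.
    by apply: eq_has_deriv_within => s _; rewrite mxE.
  rewrite /M /K /interp_map scale0r addr0 invmx1 mul1mx mulmx1.
  by case: fPA.
have Ku := interp_map_unit t01.
by rewrite -MP0 /M !mulmxA mulmxV// mul1mx mulmxKV.
Qed.

End displacement_interpolation.

(** * Optimality, uniqueness and value for endpoints [P0] and [T *m P0 *m T] *)

Section optimality.
Context (R : realType) (n : nat) (T P0 : 'M[R]_n).
Hypotheses (Tpos : posdefmx T) (P0pos : posdefmx P0).
Let P1 := T *m P0 *m T.
Let Pt t := interp_map T t *m P0 *m interp_map T t.
Let L := interp_velocity T.
Let C := \tr (L 1 *m P1) - \tr (L 0 *m P0).

Lemma cost_interp : cost Pt L = C%:E.
Proof.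
have [_ ->] := cost_completed_square Tpos (feasible_interp Tpos P0pos).
rewrite -/L -/P1 -/C; under eq_integral do rewrite subrr !mul0mx linear0.
by rewrite integral0 adde0.
Qed.

Lemma interp_minimizer : is_minimizer P0 P1 Pt L.
Proof.
split=> [|P A fPA]; first exact: feasible_interp.
have [_ ->] := cost_completed_square Tpos fPA.
rewrite cost_interp leeDl// integral_ge0// => t t01.
by rewrite lee_fin mxtrace_congr_ge0//; case: fPA => /(_ t t01).
Qed.

Lemma interp_minimizer_unique (P A : R -> 'M[R]_n) :
  is_minimizer P0 P1 P A ->
  forall t, t \in `[0, 1] -> P t = Pt t /\ A t = L t.
Proof.
move=> [fPA minPA].
suff AL t : t \in `[0, 1] -> A t = L t.
  move=> t t01; rewrite AL//; split=> //.
  exact: interp_flow_unique fPA _ t t01.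
move=> t01.
have Ppos s : s \in `[0, 1] -> posdefmx (P s) by case: fPA => + *; apply.
have := minPA _ _ (feasible_interp Tpos P0pos).
have [cg ->] := cost_completed_square Tpos fPA.
(* Both costs contain the same finite constant [C]; cancelling it leaves a nonpositive integral of a
   nonnegative remainder. *)
rewrite -/Pt -/L cost_interp -/P1 -/C -[X in (_ <= X)%E]adde0 leeD2lE// => g0.
have g0t := continuous_ge0_integral_eq0 ltr01 cg _ _ t01.
apply/eqP; rewrite -subr_eq0; apply/eqP.
apply: (mxtrace_congr_eq0 (Ppos _ t01)); apply: g0t => [s s01|].
  exact/mxtrace_congr_ge0/Ppos.
apply/eqP; rewrite eq_le g0 integral_ge0// => s s01.
by rewrite lee_fin; exact/mxtrace_congr_ge0/Ppos.
Qed.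

(** At time 1 the inverse in [L 1] cancels the left factor [T] of [P1], leaving [(T - 1) P0 T]; at
    time 0 the term is [(T - 1) P0]. *)
Lemma interp_costE : C = \tr ((T - 1%:M) *m P0 *m (T - 1%:M)^T).
Proof.
have T1 : interp_map T 1 = T by rewrite /interp_map scale1r addrC subrK.
have T0 : interp_map T 0 = 1%:M by rewrite /interp_map scale0r addr0.
rewrite /C /L /interp_velocity T1 T0 invmx1 mulmx1 /P1 !mulmxA.
rewrite mulmxKV ?posdefmx_unit// linearB/= trmx1; case: Tpos => -> _.
by rewrite [in RHS]mulmxBr mulmx1 linearB.
Qed.

Lemma optimal_value_interp :
  optimal_value P0 P1 = (\tr ((T - 1%:M) *m P0 *m (T - 1%:M)^T))%:E.
Proof.
rewrite -interp_costE -cost_interp; apply/eqP; rewrite eq_le; apply/andP; split.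
  by apply: ereal_inf_lbound; exists (Pt, L) => //=; exact: feasible_interp.
apply/ereal_infP => _ [[P A] /= fPA <-].
by have [_] := interp_minimizer; exact.
Qed.

End optimality.

(** * Identification with the closed formulas *)

Lemma invmxN (F : fieldType) (n : nat) (A : 'M[F]_n) : invmx (- A) = - invmx A.
Proof.
have [Au|Au] := boolP (A \in unitmx).
  by rewrite -scaleN1r invmxZ ?unitmxZ ?unitrN1// invrN1 scaleN1r.
(* For singular [A] both sides are the default value [- A]. *)
by rewrite !invmx_out// inE/= -scaleN1r unitmxZ ?unitrN1.
Qed.

Theorem proposition1 (R : realType) (n : nat) (P0 P1 : 'M[R]_n)
    (hP0 : posdefmx P0) (hP1 : posdefmx P1) :
  [/\ is_minimizer P0 P1 (omtP P0 P1) (omtA P0 P1),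
      forall P A : R -> 'M[R]_n, is_minimizer P0 P1 P A ->
        forall t : R, t \in `[0, 1] ->
          P t = omtP P0 P1 t /\ A t = omtA P0 P1 t,
      forall t : R, t \in `[0, 1] -> t *: omtQ P0 P1 - 1%:M \in unitmx &
      optimal_value P0 P1 =
        (frobnorm (sqrtmx P0 - sqrtmx P1 *m omtU P0 P1) ^+ 2)%:E].
Proof.
have [S0pos S0E] := sqrtmxP hP0; have [S1pos S1E] := sqrtmxP hP1.
have S0u := posdefmx_unit S0pos; have S1u := posdefmx_unit S1pos.
have S0sym := S0pos.1; have Mpos : posdefmx (sqrtmx P0 *m P1 *m sqrtmx P0).
  by rewrite -{1}S0sym; exact: posdefmx_congr.
have {Mpos}[] := sqrtmxP Mpos.
pose T := invmx (sqrtmx P0) *m sqrtmx (sqrtmx P0 *m P1 *m sqrtmx P0)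
  *m invmx (sqrtmx P0).
have QE : omtQ P0 P1 = 1%:M - T by [].
(* The root of [P1] cancels against its inverse in [omtU]. *)
have UE : sqrtmx P1 *m omtU P0 P1 = T *m sqrtmx P0.
  by rewrite /omtU /T !mulmxA mulmxV// mul1mx mulmxKV.
set M := sqrtmx (_ *m _) in T QE UE * => Mpos ME.
have Tpos : posdefmx T.
  rewrite /T -{1}(trmx_invmx_sym S0sym); apply: posdefmx_congr => //.
  by rewrite unitmx_inv.
(* The inner roots of [P0] cancel, leaving [M *m M] between two inverse roots. *)
have P1E : P1 = T *m P0 *m T.
  rewrite /T -{3}S0E !mulmxA mulmxKV// mulmxK// -(mulmxA _ M M) ME !mulmxA.
  by rewrite mulVmx// mul1mx mulmxK.
have tQE t : t *: omtQ P0 P1 - 1%:M = - interp_map T t.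
  by rewrite QE /interp_map opprD addrC -scalerN opprB.
have PE : omtP P0 P1 = fun t => interp_map T t *m P0 *m interp_map T t.
  apply/funext => t; rewrite /omtP UE; cbv zeta.
  (* The factor of [omtP] is [K_t] times the root of [P0], so its Gram product is [K_t P0 K_t]. *)
  have -> : (1 - t) *: sqrtmx P0 + t *: (T *m sqrtmx P0) =
      interp_map T t *m sqrtmx P0.
    rewrite /interp_map mulmxDl mul1mx -scalemxAl mulmxBl mul1mx.
    by rewrite scalerBl scalerBr scale1r (addrC (t *: (T *m _))) addrA.
  rewrite trmx_mul S0sym interp_map_sym//.
  by rewrite mulmxA -(mulmxA _ _ (sqrtmx P0)) S0E.
(* This equality covers every real [t], including those where [K_t] is singular, since [invmxN]
   holds there too. *)
have AE : omtA P0 P1 = interp_velocity T.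
  by apply/funext => t; rewrite /omtA tQE invmxN mulmxN -mulNmx QE opprB.
rewrite PE AE UE; split.
- by rewrite P1E; exact: interp_minimizer.
- by rewrite P1E; exact: interp_minimizer_unique.
(* On [[0, 1]] the [invmx] in [omtA] is therefore a genuine inverse. *)
- by move=> t t01; rewrite tQE -scaleN1r unitmxZ ?unitrN1// interp_map_unit.
- rewrite P1E optimal_value_interp// frobnorm_sqr; congr (_%:E).
  have -> : sqrtmx P0 - T *m sqrtmx P0 = - ((T - 1%:M) *m sqrtmx P0).
    by rewrite mulmxBl mul1mx opprB.
  rewrite linearN/= mulNmx mulmxN opprK trmx_mul S0sym.
  by rewrite mulmxA -(mulmxA _ _ (sqrtmx P0)) S0E.
Qed.
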